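(* Let $R$ be a commutative ring with identity, $M$ an $R$-module, and $\{F_i\}_{i\in\Delta}$ a nonempty chain of 2-absorbing submodules of $M$ (that is, $\Delta\neq\varnothing$ and for all $i,j\in\Delta$, $F_i\subseteq F_j$ or $F_j\subseteq F_i$). Then: (1) $\bigcap_{i\in\Delta}F_i$ is a 2-absorbing submodule of $M$. (2) If $M$ is a finitely generated $R$-module, then $\bigcup_{i\in\Delta}F_i$ is a 2-absorbing submodule of $M$.
   Context: All rings are commutative with identity and all modules are unital. For a submodule $F$ of an $R$-module $M$, $(F:_R M)=\{r\in R: rM\subseteq F\}$. A proper submodule $F$ of an $R$-module $M$ is called 2-absorbing if whenever $a,b\in R$, $m\in M$ and $abm\in F$, then $ab\in(F:_R M)$ or $am\in F$ or $bm\in F$. *)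

(* Defs.v *)
From mathcomp Require Import all_boot all_algebra.
From mathcomp Require Import boolp classical_sets.

Set Implicit Arguments.
Unset Strict Implicit.
Unset Printing Implicit Defensive.

Import GRing.Theory.

Local Open Scope classical_set_scope.
Local Open Scope ring_scope.

(* [comPzRingType] is used rather than [comNzRingType] so that the zero ring
   is allowed. Submodules are classical (Prop-valued) sets so that arbitrary
   intersections and unions can be formed. *)
Definition submodule (R : comPzRingType) (M : lmodType R) (F : set M) : Prop :=
  submod_closed [in F].

Definition colon (R : comPzRingType) (M : lmodType R) (F : set M) : set R :=
  [set r | [set r *: m | m in [set: M]] `<=` F].

Definition two_absorbing (R : comPzRingType) (M : lmodType R) (F : set M) :
    Prop :=
  [/\ submodule F, F <> [set: M] &
      forall (a b : R) (m : M), F ((a * b) *: m) ->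
        [\/ colon F (a * b), F (a *: m) | F (b *: m)]].

Definition finitely_generated (R : comPzRingType) (M : lmodType R) : Prop :=
  exists (n : nat) (g : 'I_n -> M),
    forall m : M, exists c : 'I_n -> R, m = \sum_(i < n) c i *: g i.

(* Main.v *)
Require Import Defs.
From mathcomp Require Import all_boot all_algebra.
From mathcomp Require Import boolp classical_sets.

(** Let [a * b *: m] lie in every [F i], and suppose that [a *: m] misses [F j]
and [b *: m] misses [F k]. For any [i], some member [F l] of the chain lies in
[F i], [F j] and [F k] (applying [chain_lower_bound] twice). It still misses
both vectors, so 2-absorption of [F l] puts [a * b] in the colon of [F l],
which is contained in the colon of [F i].

For the union, the 2-absorbing condition is inherited from the single member
that contains [a * b *: m]. Finite generation is needed only to see that the
union is proper: if the union were [M], then, by [chain_bigcup_finite], one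
member [F i] would contain all the generators and hence be equal to [M]. *)

Local Open Scope classical_set_scope.
Local Open Scope ring_scope.

Lemma submoduleP (R : comPzRingType) (M : lmodType R) (F : set M) :
  submodule F <->
  F 0 /\ forall (a : R) (u v : M), F u -> F v -> F (a *: u + v).
Proof.
split=> [[F0 Flin] | [F0 Flin]]; split.
- by rewrite inE in F0.
- move=> a u v Fu Fv.
  have: a *: u + v \in [in F] by apply: Flin; rewrite inE.
  by rewrite inE.
- by rewrite inE.
- by move=> a u v; rewrite !inE; apply: Flin.
Qed.

Lemma submodule_lincomb {R : comPzRingType} {M : lmodType R} {F : set M}
    {n : nat} (c : 'I_n -> R) (g : 'I_n -> M) :
  submodule F -> (forall i, F (g i)) -> F (\sum_(i < n) c i *: g i).
Proof.
move=> /submoduleP[F0 Flin] Fg.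
by apply: (big_rec F) => // i x _ Fx; apply: Flin.
Qed.

Lemma colonS (R : comPzRingType) (M : lmodType R) (F G : set M) (r : R) :
  F `<=` G -> colon F r -> colon G r.
Proof. by move=> FG Fr x /Fr /FG. Qed.

Section Chain.

Context {T Delta : Type} {F : Delta -> set T}.
Hypothesis F_chain : forall i j : Delta, F i `<=` F j \/ F j `<=` F i.

Lemma chain_lower_bound (i j : Delta) :
  exists2 l, F l `<=` F i & F l `<=` F j.
Proof. by case: (F_chain i j) => ij; [exists i | exists j]. Qed.

Lemma chain_upper_bound (i j : Delta) :
  exists2 l, F i `<=` F l & F j `<=` F l.
Proof. by case: (F_chain i j) => ij; [exists j | exists i]. Qed.

(** Nonemptiness of [Delta] matters only for [n = 0]. *)
Lemma chain_bigcup_finite (n : nat) (g : 'I_n -> T) :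
  [set: Delta] !=set0 -> (forall k, (\bigcup_(i in [set: Delta]) F i) (g k)) ->
  exists i, forall k, F i (g k).
Proof.
move=> [i0 _]; elim: n g => [|n IHn] g Ug; first by exists i0 => - [].
have [i Fi] := IHn (fun k => g (lift ord0 k)) (fun k => Ug _).
have [j _ Fj] := Ug ord0.
have [l il jl] := chain_upper_bound i j.
exists l => k; case: (unliftP ord0 k) => [k' -> | ->]; last exact: jl.
exact/il/Fi.
Qed.

End Chain.

Lemma submodule_bigcap (R : comPzRingType) (M : lmodType R) (Delta : Type)
    (F : Delta -> set M) :
  (forall i, submodule (F i)) -> submodule (\bigcap_(i in [set: Delta]) F i).
Proof.
move=> F_sub; apply/submoduleP; split=> [i _|a u v Fu Fv i _].
  by have /submoduleP[] := F_sub i.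
have /submoduleP[_ Flin] := F_sub i.
by apply: Flin; [exact: Fu | exact: Fv].
Qed.

Lemma submodule_chain_bigcup (R : comPzRingType) (M : lmodType R)
    (Delta : Type) (F : Delta -> set M) :
  [set: Delta] !=set0 -> (forall i j, F i `<=` F j \/ F j `<=` F i) ->
  (forall i, submodule (F i)) -> submodule (\bigcup_(i in [set: Delta]) F i).
Proof.
move=> [i0 _] F_chain F_sub; apply/submoduleP; split.
  by exists i0 => //; have /submoduleP[] := F_sub i0.
move=> a u v [i _ Fu] [j _ Fv].
have [l il jl] := chain_upper_bound F_chain i j.
exists l => //; have /submoduleP[_ Flin] := F_sub l.
by apply: Flin; [exact: il | exact: jl].
Qed.

Theorem proposition2p3 (R : comPzRingType) (M : lmodType R)
    (Delta : Type) (F : Delta -> set M)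
    (Delta_neq0 : [set: Delta] !=set0)
    (F_2abs : forall i : Delta, two_absorbing (F i))
    (F_chain : forall i j : Delta, F i `<=` F j \/ F j `<=` F i) :
  two_absorbing (\bigcap_(i in [set: Delta]) F i) /\
  (finitely_generated M -> two_absorbing (\bigcup_(i in [set: Delta]) F i)).
Proof.
have F_sub i : submodule (F i) by case: (F_2abs i).
have F_proper i : F i <> [set: M] by case: (F_2abs i).
split=> [|[n [g g_gen]]]; split.
- exact: submodule_bigcap.
- move=> capT; have [i0 _] := Delta_neq0; apply: (F_proper i0).
  rewrite -subTset -capT.
  exact: bigcap_inf.
- move=> a b m Fabm.
  have [|/existsNP[j /not_implyP[_ nFj]]] :=
    pselect ((\bigcap_(i in [set: Delta]) F i) (a *: m)).
    by constructor 2.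
  have [|/existsNP[k /not_implyP[_ nFk]]] :=
    pselect ((\bigcap_(i in [set: Delta]) F i) (b *: m)).
    by constructor 3.
  constructor 1 => x abx i _.
  have [p pj pk] := chain_lower_bound F_chain j k.
  have [l li lp] := chain_lower_bound F_chain i p.
  have [_ _ F_abs] := F_2abs l.
  have [Fl|Fl|Fl] := F_abs a b m (Fabm l I).
  + exact: colonS li Fl x abx.
  + by case: nFj; apply/pj/lp.
  + by case: nFk; apply/pk/lp.
- exact: submodule_chain_bigcup.
- move=> cupT.
  have [k|i Fg] := chain_bigcup_finite F_chain n g Delta_neq0.
    by rewrite cupT.
  apply: (F_proper i); rewrite -subTset => m _.
  by have [c ->] := g_gen m; apply: submodule_lincomb.
- move=> a b m [i _ Fabm].
  have [_ _ F_abs] := F_2abs i.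
  have [Fi|Fi|Fi] := F_abs a b m Fabm.
  + constructor 1; apply: colonS Fi.
    exact: bigcup_sup.
  + by constructor 2; exists i.
  + by constructor 3; exists i.
Qed.
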